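(* For every $k\in\mathbb{N}$, each of the following classes of finite graphs has asymptotic dimension at most $1$: (i) the class of graphs with rank-width at most $k$; (ii) the class of graphs with tree independence number at most $k$; (iii) the class of graphs with mim-width at most $k$; (iv) the class of graphs with sim-width at most $k$.
   Context: $\mathbb{N}$ is the set of positive integers. Graphs are simple, undirected, unweighted and finite. $\operatorname{dist}_G(u,v)$ is the length of a shortest path between $u$ and $v$ in $G$, and is $\infty$ if no such path exists; $\operatorname{dist}_G(X,Y)$ is the minimum of $\operatorname{dist}_G(x,y)$ over $x\in X$, $y\in Y$. The weak diameter of $X\subseteq V(G)$ is the maximum of $\operatorname{dist}_G(u,v)$ over $u,v\in X$. Asymptotic dimension: for $\delta\ge 0$, a collection $\mathcal{U}$ of subsets of $V(G)$ is $\delta$-disjoint if $\operatorname{dist}_G(X,Y)>\delta$ for all distinct $X,Y\in\mathcal{U}$; it is $(m,\delta)$-disjoint if $\mathcal{U}=\bigcup_{i=1}^m\mathcal{U}_i$ where each $\mathcal{U}_i$ is a $\delta$-disjoint subcollection of $\mathcal{U}$. A function $f\colon[0,\infty)\to[0,\infty)$ is a $d$-dimensional control function for $G$ if for every $\delta\ge0$ there is a $(d+1,\delta)$-disjoint partition $\mathcal{U}$ of $V(G)$ into sets of weak diameter at most $f(\delta)$ in $G$. The asymptotic dimension of a class $\mathcal{G}$ of graphs is the minimum $d$ for which there is a single function $f$ that is a $d$-dimensional control function for every $G\in\mathcal{G}$ (infinite if no such $d$ exists). Tree independence number: a tree-decomposition of $G$ is a pair $(T,\beta)$ with $T$ a tree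 and $\beta\colon V(T)\to 2^{V(G)}$ such that every edge of $G$ has both ends in some bag $\beta(x)$, and for every $v\in V(G)$ the set $\{x\in V(T): v\in\beta(x)\}$ induces a non-empty connected subtree of $T$. The independence number of $(T,\beta)$ is $\max_x \alpha(G[\beta(x)])$, where $\alpha$ is the maximum size of an independent set; the tree independence number of $G$ is the minimum independence number of a tree-decomposition of $G$. Branch-decompositions: a branch-decomposition of $G$ is a pair $(T,L)$ where $T$ is a subcubic tree (maximum degree at most $3$) and $L$ is a bijection from $V(G)$ to the set of leaves of $T$. Each edge $e$ of $T$ gives a partition $(A_1^e,A_2^e)$ of $V(G)$, where $A_i^e$ is the set of vertices mapped to leaves in the $i$-th component of $T-e$. For a function $f\colon 2^{V(G)}\to\{0,1,2,\dots\}$ that is symmetric under complementation, the $f$-width of $(T,L)$ is the maximum of $f(A_1^e)$ over edges $e$ of $T$, and the corresponding width of $G$ is the minimum $f$-width of a branch-decomposition of $G$ (taken to be $0$ if $|V(G)|\le 1$). - Rank-width: $f(A)$ is the rank over the two-element field of the $A\times(V(G)\setminus A)$ submatrix of the adjacency matrix of $G$. - Mim-width: $f(A)$ is the maximum size of an induced matching in the bipartite graph consisting of the edges of $G$ between $A$ and $V(G)\setminus A$. - Sim-width: $f(A)$ is the maximum size $m$ of an induced matching $\{a_1b_1,\dots,a_mb_m\}$ in $G$ itself with all $a_i\in A$ and all $b_i\in V(G)\setminus A$. *)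

(* Defs.v *)
From mathcomp Require Import all_boot all_order all_algebra.
From mathcomp Require Import boolp classical_sets reals ereal.

Set Implicit Arguments.
Unset Strict Implicit.
Unset Printing Implicit Defensive.

Import Order.TTheory GRing.Theory Num.Theory.

Local Open Scope ereal_scope.
Local Open Scope nat_scope.

(* The minimum of a set of natural numbers, +oo if the set is empty; as the
   elements are natural numbers, the infimum is attained as soon as it is
   finite. *)
Definition min_nat (R : realType) (P : nat -> Prop) : \bar R :=
  ereal_inf [set (n%:R)%:E | n in P]%classic.

Record sgraph := SGraph {
  vertex :> finType;
  adj : rel vertex;
  adj_sym : symmetric adj;
  adj_irr : irreflexive adj
}.

Arguments adj {s}.

Definition gdist (R : realType) (G : sgraph) (u v : G) : \bar R :=
  min_nat R (fun n => exists p : seq G,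
    [/\ path adj u p, uniq (u :: p), last u p = v & size p = n]).

Definition set_dist (R : realType) (G : sgraph) (X Y : {set G}) : \bar R :=
  \big[mine/+oo]_(x in X) \big[mine/+oo]_(y in Y) gdist R x y.

Definition weak_diameter (R : realType) (G : sgraph) (X : {set G}) : \bar R :=
  \big[maxe/0%E]_(u in X) \big[maxe/0%E]_(v in X) gdist R u v.

Definition delta_disjoint (R : realType) (G : sgraph) (delta : R)
    (U : {set {set G}}) : Prop :=
  forall X Y : {set G}, X \in U -> Y \in U -> X != Y ->
    (delta%:E < set_dist R X Y)%E.

Definition m_delta_disjoint (R : realType) (G : sgraph) (m : nat) (delta : R)
    (U : {set {set G}}) : Prop :=
  exists C : 'I_m -> {set {set G}},
    U = \bigcup_(i < m) C i /\ forall i, delta_disjoint delta (C i).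

(* Functions from [0, oo) to [0, oo) are represented by functions on R that
   are nonnegative at nonnegative arguments; their values at negative
   arguments are irrelevant. *)
Definition control_function (R : realType) (d : nat) (f : R -> R)
    (G : sgraph) : Prop :=
  forall delta : R, (0 <= delta)%R ->
    exists U : {set {set G}},
      [/\ finset.partition U [set: G], m_delta_disjoint d.+1 delta U
        & forall X, X \in U -> (weak_diameter R X <= (f delta)%:E)%E].

Definition asdim (R : realType) (C : sgraph -> Prop) : \bar R :=
  min_nat R (fun d => exists f : R -> R,
    (forall x : R, (0 <= x)%R -> (0 <= f x)%R) /\
    forall G : sgraph, C G -> control_function d f G).

Definition connected_set (G : sgraph) (S : {set G}) : Prop :=
  (exists x, x \in S) /\
  forall x y, x \in S -> y \in S ->
    connect [rel a b : G | [&& a \in S, b \in S & adj a b]] x y.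

Definition acyclic (G : sgraph) : Prop :=
  forall c : seq G, 2 < size c -> ~ ucycle adj c.

Definition is_tree (T : sgraph) : Prop :=
  connected_set [set: T] /\ acyclic T.

Definition degree (G : sgraph) (x : G) : nat := #|[set y | adj x y]|.

Definition leaves (T : sgraph) : {set T} := [set x | degree x == 1].

Definition stable (G : sgraph) (S : {set G}) : bool :=
  [forall x in S, forall y in S, ~~ adj x y].

(* The independence number of the subgraph induced by X *)
Definition alpha (G : sgraph) (X : {set G}) : nat :=
  \max_(S : {set G} | (S \subset X) && stable S) #|S|.

Definition tree_decomposition (G T : sgraph) (beta : T -> {set G}) : Prop :=
  [/\ is_tree T,
      forall u v : G, adj u v -> exists x, u \in beta x /\ v \in beta x
    & forall v : G, connected_set [set x | v \in beta x]].

Definition tree_independence_number (R : realType) (G : sgraph) : \bar R :=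
  min_nat R (fun n => exists (T : sgraph) (beta : T -> {set G}),
    tree_decomposition beta /\ \max_(x : T) alpha (beta x) = n).

Definition branch_decomposition (G T : sgraph) (L : G -> T) : Prop :=
  [/\ is_tree T, forall x : T, degree x <= 3, injective L
    & [set L v | v in [set: G]] = leaves T].

Definition edge_deleted (T : sgraph) (x y : T) : rel T :=
  [rel a b | adj a b && ([set a; b] != [set x; y])].

(* For an edge xy of T, the vertices mapped to leaves in the component of
   T - xy that contains x; the other side of the partition is
   branch_side L y x. *)
Definition branch_side (G T : sgraph) (L : G -> T) (x y : T) : {set G} :=
  [set v | connect (edge_deleted x y) x (L v)].

(* Each edge of T is met in both orientations, which is harmless for a
   function f that is symmetric under complementation. *)
Definition branch_decomposition_width (G T : sgraph) (f : {set G} -> nat)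
    (L : G -> T) : nat :=
  \max_(x : T) \max_(y : T | adj x y) f (branch_side L x y).

Definition branch_width (R : realType) (G : sgraph) (f : {set G} -> nat) :
    \bar R :=
  if #|G| <= 1 then 0%E else
  min_nat R (fun n => exists (T : sgraph) (L : G -> T),
    branch_decomposition L /\ branch_decomposition_width f L = n).

Definition cut_rank (G : sgraph) (A : {set G}) : nat :=
  \rank (\matrix_(i < #|A|, j < #|~: A|)
    ((adj (enum_val i) (enum_val j))%:R : 'F_2))%R.

Definition edges (G : sgraph) : {set {set G}} :=
  [set e | [exists x : G, exists y : G, adj x y && (e == [set x; y])]].

Definition cut_adj (G : sgraph) (A : {set G}) : rel G :=
  [rel x y | adj x y && ((x \in A) != (y \in A))].

Lemma cut_adj_sym (G : sgraph) (A : {set G}) : symmetric (cut_adj A).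
Proof. by move=> x y; rewrite /cut_adj /= adj_sym eq_sym. Qed.

Lemma cut_adj_irr (G : sgraph) (A : {set G}) : irreflexive (cut_adj A).
Proof. by move=> x; rewrite /cut_adj /= adj_irr. Qed.

Definition cut_graph (G : sgraph) (A : {set G}) : sgraph :=
  SGraph (cut_adj_sym A) (cut_adj_irr A).

(* A matching M (a set of pairwise disjoint edges) is induced if the subgraph
   induced by the ends of its edges has no edge outside M. *)
Definition induced_matching (G : sgraph) (M : {set {set G}}) : bool :=
  [&& M \subset edges G, finset.trivIset M
    & [forall e in edges G, (e \subset finset.cover M) ==> (e \in M)]].

Definition cut_mim (G : sgraph) (A : {set G}) : nat :=
  \max_(M : {set {set cut_graph A}} | induced_matching M) #|M|.

Definition cut_sim (G : sgraph) (A : {set G}) : nat :=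
  \max_(M : {set {set G}} | induced_matching M
                            && (M \subset edges (cut_graph A))) #|M|.

Definition rank_width (R : realType) (G : sgraph) : \bar R :=
  branch_width R (@cut_rank G).

Definition mim_width (R : realType) (G : sgraph) : \bar R :=
  branch_width R (@cut_mim G).

Definition sim_width (R : realType) (G : sgraph) : \bar R :=
  branch_width R (@cut_sim G).

(* Main.v *)
(* For every scale m it suffices to 2-colour the vertices so that the
   monochromatic components of the m-th power of G have bounded weak diameter.

   In a branch-decomposition of small sim-width, a maximal induced matching
   among the edges of a cut dominates all edges of the cut, so the vertices
   near a cut are covered by boundedly many balls of bounded radius.  In a
   tree-decomposition with bags of small independence number, a maximal stable
   set dominates its bag.  Either way the m-th power of G has a
   tree-decomposition whose bags are covered by k balls of bounded radius r.

   Such graphs are coloured by induction on k.  Colour the two layers around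
   the root bag with two different colours, which confines every component
   meeting the root bag to its closed neighbourhood.  The bags reached by these
   layers form an upper part of the tree; each has one of its k balls close to
   the root bag, so outside a ball S around the root bag they need only k - 1
   balls and can be coloured by induction, at a scale M exceeding the diameter
   of the confined components.  Each subtree hanging below is then coloured
   recursively, extending the colouring of its root bag.  A component entering
   a subtree and returning is confined there, hence returns within distance M
   inside a single bag of the upper part, so it does not merge components of
   the scale-M colouring. *)
Require Import Defs.
From mathcomp Require Import all_boot all_order all_algebra.
From mathcomp Require Import boolp classical_sets reals ereal.
From mathcomp Require Import zify.

Set Implicit Arguments.
Unset Strict Implicit.
Unset Printing Implicit Defensive.

Import Order.TTheory GRing.Theory Num.Theory.

(** * Balls and coverings *)

Section Near.
Variable G : sgraph.
Implicit Types (u v w : G) (B : {set G}).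

(** Walks rather than simple paths, so that concatenation is free; [gdist_le] shortens them at the
    end. *)
Definition near n u v : bool :=
  `[< exists p, [/\ path adj u p, last u p = v & size p <= n] >].

Lemma nearW m n u v : m <= n -> near m u v -> near n u v.
Proof.
move=> mn /asboolP[p [pp lp sp]]; apply/asboolP; exists p; split=> //.
exact: leq_trans sp mn.
Qed.

Lemma near_refl n u : near n u u.
Proof. by apply/asboolP; exists [::]. Qed.

Lemma near_adj u v : adj u v -> near 1 u v.
Proof. by move=> uv; apply/asboolP; exists [:: v]; rewrite /= uv. Qed.

Lemma near_trans m n v u w : near m u v -> near n v w -> near (m + n) u w.
Proof.
move=> /asboolP[p [pp lp sp]] /asboolP[q [pq lq sq]]; apply/asboolP.
exists (p ++ q); rewrite cat_path last_cat lp pp pq size_cat; split=> //.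
exact: leq_add.
Qed.

Lemma nearS n u v :
  near n.+1 u v -> u = v \/ exists2 w, near n u w & adj w v.
Proof.
move=> /asboolP[p []]; case/lastP: p => [|p z] pp lp sp; first by left.
right; move: pp lp sp; rewrite rcons_path last_rcons size_rcons.
move=> /andP[pp az] <- sp; exists (last u p) => //.
by apply/asboolP; exists p.
Qed.

Lemma near_eq0 u v : near 0 u v -> u = v.
Proof. by move=> /asboolP[[|? ?] []]. Qed.

Lemma near_sym n : symmetric (near n).
Proof.
suff H u v : near n u v -> near n v u by move=> u v; apply/idP/idP; apply: H.
elim: n u v => [|n IH] u v; first by move=> /near_eq0->; exact: near_refl.
move=> /nearS[->|[w uw wv]]; first exact: near_refl.
by rewrite -add1n; apply: near_trans (IH _ _ uw); rewrite adj_sym in wv;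
  exact: near_adj.
Qed.

Lemma near_exit n (P : pred G) v w : near n v w -> P v -> ~~ P w ->
  exists a b, [/\ adj a b, P a, ~~ P b, near n v a & near n v b].
Proof.
elim: n w => [|n IH] w; first by move=> /near_eq0-> ->.
move=> /nearS[-> ->//|[y vy yw]] Pv Pw.
have vy' : near n.+1 v y by exact: nearW vy.
have [Py|Py] := boolP (P y).
  exists y, w; split=> //; rewrite -addn1; apply: near_trans vy _.
  exact: near_adj.
have [a [b [ab Pa Pb va vb]]] := IH _ vy Pv Py.
by exists a, b; split=> //; [exact: nearW va|exact: nearW vb].
Qed.

(** Whichever side of [P] contains [v], one of the two walks changes sides. *)
Lemma near_cross n (P : pred G) v w w' :
  near n v w -> near n v w' -> P w -> ~~ P w' ->
  exists a b, [/\ adj a b, P a, ~~ P b, near n v a & near n v b].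
Proof.
move=> vw vw' Pw Pw'; have [Pv|Pv] := boolP (P v); first exact: near_exit Pw'.
have [|b [a [ba Pb Pa vb va]]] := near_exit (P := predC P) vw Pv.
  by rewrite /= negbK.
by exists a, b; split=> //; [rewrite adj_sym|move: Pa; rewrite /= negbK].
Qed.

Definition covered k r B : Prop :=
  exists2 s : seq G, size s <= k &
    forall v, v \in B -> exists2 z, z \in s & near r z v.

Lemma coveredW k r k' r' B B' : k <= k' -> r <= r' -> B' \subset B ->
  covered k r B -> covered k' r' B'.
Proof.
move=> kk rr BB [s sk H]; exists s; first exact: leq_trans kk.
move=> v /(fintype.subsetP BB)/H[z zs zv]; exists z => //; exact: nearW zv.
Qed.

Lemma covered_near k r a B B' : covered k r B ->
  (forall v, v \in B' -> exists2 z, z \in B & near a z v) ->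
  covered k (r + a) B'.
Proof.
move=> [s sk H] HB; exists s => // v /HB[w /H[z zs zw] wv]; exists z => //.
exact: near_trans zw wv.
Qed.

Lemma coveredU k k' r B B' : covered k r B -> covered k' r B' ->
  covered (k + k') r (B :|: B').
Proof.
move=> [s sk H] [s' sk' H']; exists (s ++ s').
  by rewrite size_cat leq_add.
move=> v; rewrite inE => /orP[/H|/H'][z zs zv]; exists z => //.
  by rewrite mem_cat zs.
by rewrite mem_cat zs orbT.
Qed.

Lemma covered_bigU (I : finType) (J : {set I}) k r (F : I -> {set G}) :
  (forall i, i \in J -> covered k r (F i)) ->
  covered (#|J| * k) r (\bigcup_(i in J) F i).
Proof.
move=> H; rewrite -sum1_card big_distrl /=.
have /boolp.choice[s Hs] i : exists s : seq G, i \in J -> size s <= k /\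
    forall v, v \in F i -> exists2 z, z \in s & near r z v.
  have [iJ|_] := boolP (i \in J); last by exists [::].
  by have [s sk Hs] := H i iJ; exists s.
exists (flatten [seq s i | i <- enum J]).
  rewrite size_flatten /shape -map_comp sumnE big_map big_enum /=.
  by apply: leq_sum => i /Hs[+ _]; rewrite mul1n.
move=> v /finset.bigcupP[i iJ vi]; have [_ /(_ v vi)[z zs zv]] := Hs i iJ.
exists z => //; apply/flattenP; exists (s i) => //.
by apply/mapP; exists i => //; rewrite mem_enum.
Qed.

(** Jump from [u] to the last vertex of the walk inside the ball around [z] that contains [u]: this
    costs [2 * r], and [l] for the next step. The rest of the walk avoids that ball, so one centre
    fewer suffices; the length of the walk never enters. *)
Lemma path_near (e : rel G) l r s u p :
  (forall x y, e x y -> near l x y) -> path e u p ->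
  (forall w, w \in u :: p -> exists2 z, z \in s & near r z w) ->
  near (size s * (2 * r + l)) u (last u p).
Proof.
move=> el; have [n] := ubnP (size s); elim: n s u p => // n IH s u p sn pp Hs.
have [z zs zu] := Hs u (mem_head _ _).
have ss : size s = (size (rem z s)).+1.
  by rewrite size_rem // prednK //; case: (s) zs.
have far q1 w q2 : near r z w -> u :: p = q1 ++ w :: q2 ->
    {in q2, forall y, ~~ near r z y} ->
    near (size s * (2 * r + l)) u (last u p).
  move=> zw Ep far.
  have uw : near (2 * r) u w.
    by rewrite mul2n -addnn; apply: near_trans zw; rewrite near_sym.
  have pq : path e w q2.
    case: q1 Ep => [[<- <-]//|_ q1 [_ Ep]]; move: pp.
    by rewrite Ep cat_path /= => /and3P[].
  have -> : last u p = last w q2.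
    by rewrite -[last u p]/(last u (u :: p)) Ep last_cat.
  have sub y : y \in q2 -> y \in u :: p.
    by rewrite Ep mem_cat inE => ->; rewrite !orbT.
  case: q2 far pq sub {Ep} => [|w' q2] far pq sub /=.
    by apply: nearW uw; rewrite ss mulSn; lia.
  move: pq => /= /andP[ww' pq].
  rewrite ss mulSn; apply: near_trans; first exact: near_trans uw (el _ _ ww').
  apply: IH => //; first by rewrite -ltnS -ss.
  move=> y yq; have [z' z's zy] := Hs y (sub y yq).
  exists z' => //; rewrite remE mem_cat.
  have zz' : z' != z by apply: contraTneq zy => ->; exact: far.
  move: z's; rewrite -{1}(cat_take_drop (index z s) s) mem_cat.
  case/orP => [->//|]; rewrite (drop_nth z) ?index_mem // nth_index //.
  by rewrite inE (negPf zz') /= => ->; rewrite orbT.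
suff [q1 [w [q2 [zw Ep fq]]]] : exists q1 w q2, [/\ near r z w,
    u :: p = q1 ++ w :: q2 & {in q2, forall y, ~~ near r z y}].
    exact: far zw Ep fq.
  elim/last_ind: p {pp Hs far} => [|p y [q1 [w [q2 [zw Ep far]]]]].
    by exists [::], u, [::].
  have [zy|zy] := boolP (near r z y).
    by exists (u :: p), y, [::]; rewrite -rcons_cons cats1.
  exists q1, w, (rcons q2 y).
  rewrite -rcons_cons Ep rcons_cat; split=> // y'.
  by rewrite mem_rcons inE => /orP[/eqP->|/far].
Qed.

Lemma connect_near (e : rel G) l k r (K : {set G}) u v :
  (forall x y, e x y -> near l x y) -> covered k r K ->
  (forall w, connect e u w -> w \in K) -> connect e u v ->
  near (k * (2 * r + l)) u v.
Proof.
move=> el [s sk Hs] HK /connectP[p pp ->].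
apply: nearW (path_near (s := s) (r := r) el pp _); first by rewrite leq_mul2r sk orbT.
by move=> w wp; apply/Hs/HK/(path_connect pp).
Qed.

End Near.

(** * Rooted trees *)

Section RootedTree.
Variables (T : finType) (t0 : T) (pi : T -> T) (h : T -> nat).

(** [h] is any rank that strictly decreases towards the root; it drives the inductions along
    [pi]. *)
Definition rooted : Prop :=
  pi t0 = t0 /\ forall i, i != t0 -> h (pi i) < h i.

Definition desc : rel T := fconnect pi.

Definition sub (i : T) : {set T} := [set j | desc j i].

Lemma desc_refl i : desc i i. Proof. exact: connect0. Qed.

Lemma desc_trans j i l : desc i j -> desc j l -> desc i l.
Proof. exact: connect_trans. Qed.

Lemma desc_parent i : desc i (pi i). Proof. exact: fconnect1. Qed.

Lemma descP i j : reflect (exists n, iter n pi i = j) (desc i j).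
Proof.
apply: (iffP idP) => [ij|[n <-]]; last exact: fconnect_iter.
by exists (findex pi i j); exact: iter_findex.
Qed.

Lemma desc_step i j : desc i j -> i = j \/ desc (pi i) j.
Proof.
move=> /descP[[|n] <-]; first by left.
by right; rewrite iterSr; exact: fconnect_iter.
Qed.

Lemma desc_chain s i j : desc s i -> desc s j -> desc i j \/ desc j i.
Proof.
move=> /descP[m <-] /descP[n <-]; have [mn|mn] := leqP m n.
  by left; apply/descP; exists (n - m); rewrite -iterD subnK.
by right; apply/descP; exists (m - n); rewrite -iterD subnK // ltnW.
Qed.

Hypothesis rT : rooted.

Lemma desc_ltn i j : desc i j -> i != j -> h j < h i.
Proof.
have [pt0 hpi] := rT.
move=> /descP[n <-{j}]; elim: n i => [|n IH] i; first by rewrite eqxx.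
rewrite iterSr; have [->|it0] := eqVneq i t0.
  by rewrite pt0 iter_fix // eqxx.
move=> _; have [<-|ne] := eqVneq (pi i) (iter n pi (pi i)); first exact: hpi.
exact: ltn_trans (IH _ ne) (hpi _ it0).
Qed.

Lemma desc_anti i j : desc i j -> desc j i -> i = j.
Proof.
move=> ij ji; apply/eqP/negPn/negP => ne.
by have := ltn_trans (desc_ltn ij ne) (desc_ltn ji _); rewrite ltnn eq_sym => /(_ ne).
Qed.

Lemma desc_root i : desc i t0.
Proof.
have [n] := ubnP (h i); elim: n i => // n IH i hi.
have [->|it0] := eqVneq i t0; first exact: desc_refl.
apply: desc_trans (desc_parent i) (IH _ _).
by apply: leq_trans (rT.2 _ it0) _.
Qed.

Lemma parent_sub i j : desc i j -> i != j -> desc (pi i) j.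
Proof. by move=> /desc_step[->|//]; rewrite eqxx. Qed.

Lemma desc_parentN i : i != t0 -> ~~ desc (pi i) i.
Proof.
move=> it0; apply/negP => pii; have := rT.2 _ it0.
by rewrite -(desc_anti (desc_parent i) pii) ltnn.
Qed.

(* The node set of each vertex is a subtree: it is closed under taking
   parents, except at its topmost node. *)
Definition subtree_bags (V : finType) (beta : T -> {set V}) : Prop :=
  forall v, exists t, forall i, v \in beta i ->
    i = t \/ i != t0 /\ v \in beta (pi i).

Section Bags.
Variables (V : finType) (beta : T -> {set V}).
Hypothesis sb : subtree_bags beta.

(** All nodes of [v] lie below its topmost node [t]. Since [s'] is not below [i], neither is [t], so
    the climb from [s] to [t] leaves the subtree of [i] through [i] and [pi i]. *)
Lemma bags_separate v i s s' : v \in beta s -> desc s i ->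
  v \in beta s' -> ~~ desc s' i -> v \in beta i /\ v \in beta (pi i).
Proof.
have [t tv] := sb v.
have up j : v \in beta j -> desc j t.
  have [n] := ubnP (h j); elim: n j => // n IH j hj /tv[->|[jt0 pj]].
    exact: desc_refl.
  apply: desc_trans (desc_parent j) (IH _ _ pj).
  exact: leq_trans (rT.2 _ jt0) _.
move=> + + vs' Ns'; have [n] := ubnP (h s); elim: n s => // n IH s hs vs si.
have tNi : ~~ desc t i by apply: contra Ns'; apply: desc_trans (up _ vs').
case: (tv _ vs) => [st|[st0 ps]]; first by rewrite -st si in tNi.
have [<-//|si'] := eqVneq s i.
apply: IH ps (parent_sub si si'); exact: leq_trans (rT.2 _ st0) _.
Qed.

End Bags.
End RootedTree.

(** * Colouring along a tree-decomposition with coverable bags *)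

Section Colouring.
Variable G : sgraph.

Definition mono (c : G -> bool) (e : rel G) : rel G :=
  [rel u v | e u v && (c u == c v)].

Lemma mono_sym c e : symmetric e -> symmetric (mono c e).
Proof. by move=> se u v; rewrite /mono /= se eq_sym. Qed.

Lemma connect_mono c e u v : connect (mono c e) u v -> c u = c v.
Proof.
move=> /connectP[p + ->]; elim: p u => //= w p IH u /andP[/andP[_ /eqP->]].
exact: IH.
Qed.

Variables (T : finType).

(** The coarse graph to be coloured. Distances are measured in all of [G], not inside the bags. *)
Definition share r (beta : T -> {set G}) (X : {set T}) : rel G :=
  [rel u v | near r u v && [exists t in X, (u \in beta t) && (v \in beta t)]].

Lemma share_sym r (beta : T -> {set G}) (X : {set T}) : symmetric (share r beta X).
Proof.
move=> u v; rewrite /share /= near_sym; congr (_ && _).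
by apply: eq_existsb => t; rewrite (andbC (u \in _)).
Qed.

Lemma shareP r (beta : T -> {set G}) (X : {set T}) u v : reflect
  (near r u v /\ exists t, [/\ t \in X, u \in beta t & v \in beta t])
  (share r beta X u v).
Proof.
apply: (iffP andP) => -[uv]; last first.
  by move=> [t [tX ut vt]]; split=> //; apply/existsP; exists t; rewrite tX ut.
by move=> /existsP[t /and3P[tX ut vt]]; split=> //; exists t.
Qed.

End Colouring.

(** * Extending a colouring of the root bag down the tree *)

Section Extend.
Variables (G : sgraph) (T : finType) (t0 : T) (pi : T -> T) (h : T -> nat).
Variables (beta : T -> {set G}) (k r D' : nat).
Hypothesis rT : rooted t0 pi h.
Hypothesis sb : subtree_bags t0 pi beta.
Hypothesis cov : forall t, covered k.+1 r (beta t).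

Local Notation desc := (desc pi).
Local Notation sub := (sub pi).

(** [M] bounds a component trapped in the first layer: [k.+1] balls of radius [2 * r], steps of
    length [r]. [D1] bounds a component of the upper part: either [D'], or [k.+1] balls of radius
    [5 * r + M + D'] with steps of length [M]. [D] adds an excursion of length [M] at each end. *)
Let M := k.+1 * (5 * r).
Let D1 := D' + k.+1 * (2 * (5 * r + M + D') + M).
Let D := M + D1 + M.

Hypothesis colour_fewer : forall beta' : T -> {set G},
  subtree_bags t0 pi beta' -> (forall t, covered k M (beta' t)) ->
  exists c : G -> bool,
    forall u v, connect (mono c (share M beta' [set: T])) u v -> near D' u v.

(** The last clause makes an excursion below a child node cost one step of length [M]; the second
    handles components lying entirely below such a node. Both bounds are the same at every node, so
    the recursion loses nothing. *)
Let good x (c0 c : G -> bool) := [/\ {in beta x, c =1 c0},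
  forall u v, connect (mono c (share r beta (sub x))) u v -> near D u v &
  forall u v, u \in beta x ->
    connect (mono c (share r beta (sub x))) u v -> near M u v].

Section Node.
Variables (x : T) (c0 : G -> bool).
Hypothesis extend_below : forall y, desc y x -> y != x ->
  forall c0', exists c, good y c0' c.

Let e := share r beta (sub x).
Let layer (N : {set G}) := N :|: [set v | [exists z in N, e z v]].
Let N0 := beta x.
Let N1 := layer N0.
Let N2 := layer N1.
(** The upper part of the subtree of [x]. The node [x] is added by hand because its bag may be
    empty. *)
Let T' := [set t in sub x | (t == x) || [exists v in N2, v \in beta t]].
(** Layer vertices are within [2 * r] of the root bag, and two points of a ball of radius [r] are
    within [2 * r]; hence the radius [4 * r]. *)
Let S := [set v | [exists z in N0, near (4 * r) z v]].
Let C := [set y in sub x | (y \notin T') && (pi y \in T')].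
Let V' := \bigcup_(t in T') beta t.
Let below y := \bigcup_(t in sub y) beta t.

Lemma layer_sub (N : {set G}) : N \subset layer N.
Proof. exact: finset.subsetUl. Qed.

Lemma layerP (N : {set G}) v : v \in layer N ->
  v \in N \/ exists2 z, z \in N & e z v.
Proof.
by rewrite !inE => /orP[->|/existsP[z /andP[zN zv]]]; [left|right; exists z].
Qed.

Lemma layer_edge (N : {set G}) z v : z \in N -> e z v -> v \in layer N.
Proof.
move=> zN zv; rewrite !inE; apply/orP; right.
by apply/existsP; exists z; rewrite zN.
Qed.

(** This property of [N2] makes [T'] closed under ancestors up to [x], see [T'_up]. *)
Let visible (N : {set G}) := forall z s t, z \in N -> z \in beta s ->
  desc s t -> desc t x -> exists2 z', z' \in N & z' \in beta t.

Lemma visible_N0 : visible N0.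
Proof.
move=> z s t zx zs st tx; exists z => //.
have [<-//|ne] := eqVneq x t.
have [|//] := bags_separate rT sb zs st zx.
by apply: contraNN ne => xt; rewrite (desc_anti rT xt tx).
Qed.

(** A new vertex [v] shares a bag [s'] with some [z] in [N]. If [s'] is below [t], visibility of [N]
    applies to [z]; otherwise [v] has bags on both sides of [t] and so occurs at [t] itself. *)
Lemma visible_layer N : visible N -> visible (layer N).
Proof.
move=> vN v s t vL; case/layerP: (vL) => [vN'|[z zN /shareP[_ [s' [s'x zs' vs']]]]] vs st tx.
  have [z zN zt] := vN _ _ _ vN' vs st tx.
  by exists z => //; apply: (fintype.subsetP (layer_sub N)).
have [s't|s't] := boolP (desc s' t).
  have [z' z'N z't] := vN _ _ _ zN zs' s't tx.
  by exists z' => //; apply: (fintype.subsetP (layer_sub N)).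
have [vt _] := bags_separate rT sb vs st vs' s't.
by exists v.
Qed.

Lemma N0_T' : N0 \subset V'.
Proof.
apply: finset.bigcup_sup; rewrite inE eqxx inE.
by rewrite desc_refl.
Qed.

Lemma visible_N2 : visible N2.
Proof. exact/visible_layer/visible_layer/visible_N0. Qed.

Lemma T'P t : t \in T' -> desc t x.
Proof. by rewrite !inE => /andP[]. Qed.

Lemma x_T' : x \in T'.
Proof. by rewrite !inE eqxx andbT desc_refl. Qed.

Lemma T'_up t y : t \in T' -> desc t y -> desc y x -> y \in T'.
Proof.
rewrite !inE => /andP[tx tT] ty yx; rewrite yx /=.
case/orP: tT => [/eqP tx'|/existsP[v /andP[vN vt]]].
  by rewrite tx' in ty; rewrite (desc_anti rT yx ty) eqxx.
have [z zN zy] := visible_N2 vN vt ty yx.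
by apply/orP; right; apply/existsP; exists z; rewrite zN.
Qed.

Lemma C_desc y : y \in C -> desc y x.
Proof. by rewrite !inE => /andP[]. Qed.

Lemma C_neq y : y \in C -> y != x.
Proof.
rewrite finset.in_set => /and3P[_ + _].
by apply: contraNneq => ->; exact: x_T'.
Qed.

Lemma C_cover s : desc s x -> s \notin T' -> exists2 y, y \in C & desc s y.
Proof.
have [n] := ubnP (h s); elim: n s => // n IH s hs sx sT.
have s_x : s != x by apply: contraNneq sT => ->; exact: x_T'.
have psx : desc (pi s) x by exact: parent_sub.
have s_t0 : s != t0.
  by apply: contraNneq s_x => st0; rewrite st0 in sx *;
    rewrite (desc_anti rT sx (desc_root rT x)).
have [psT|psT] := boolP (pi s \in T').
  by exists s; [rewrite finset.in_set sT psT inE sx|exact: desc_refl].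
have [|y yC sy] := IH _ _ psx psT; first exact: leq_trans (rT.2 _ s_t0) _.
by exists y => //; apply: desc_trans sy; exact: desc_parent.
Qed.

Lemma C_uniq y y' s : y \in C -> y' \in C -> desc s y -> desc s y' -> y = y'.
Proof.
move=> yC y'C sy sy'.
wlog yy' : y y' yC y'C sy sy' / desc y y'.
  move=> H; case: (desc_chain sy sy') => yy'; first exact: H.
  by apply/esym/H.
apply/eqP/negPn/negP => ne.
have := y'C; rewrite finset.in_set => /and3P[_ /negP + _]; apply.
move: (yC); rewrite finset.in_set => /and3P[_ _ pyT].
exact: T'_up pyT (parent_sub yy' ne) (C_desc y'C).
Qed.

Lemma T'_below t y : t \in T' -> y \in C -> ~~ desc t y.
Proof.
move=> tT yC; apply/negP => ty; have := yC; rewrite finset.in_set => /and3P[_ /negP + _].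
by apply; exact: T'_up tT ty (C_desc yC).
Qed.

Lemma V'P v : reflect (exists2 t, t \in T' & v \in beta t) (v \in V').
Proof. exact: finset.bigcupP. Qed.

Lemma belowP y v : reflect (exists2 s, desc s y & v \in beta s) (v \in below y).
Proof.
by apply: (iffP finset.bigcupP) => -[s]; rewrite ?inE; exists s; rewrite ?inE.
Qed.

Lemma adhesion y v s : y \in C -> v \in below y -> v \in beta s ->
  ~~ desc s y -> v \in beta y /\ v \in beta (pi y).
Proof.
move=> yC /belowP[s' s'y vs'] vs sy.
exact: (bags_separate rT sb vs' s'y vs sy).
Qed.

Lemma adhesion_V' y v : y \in C -> v \in below y -> v \in V' ->
  v \in beta y /\ v \in beta (pi y).
Proof. by move=> yC vy /V'P[t tT vt]; apply: adhesion vt _ => //; exact: T'_below. Qed.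

Lemma below_uniq y y' v : y \in C -> y' \in C -> v \in below y ->
  v \in below y' -> v \notin V' -> y = y'.
Proof.
move=> yC y'C vy /belowP[s sy' vs] vV; have [sy|sy] := boolP (desc s y).
  exact: C_uniq sy sy'.
have [_ vpy] := adhesion yC vy vs sy; case/negP: vV; apply/V'P; exists (pi y) => //.
by move: yC; rewrite finset.in_set => /and3P[].
Qed.

Lemma near_N2 v : v \in N2 -> exists2 z, z \in N0 & near (2 * r) z v.
Proof.
have step (N : {set G}) a w : (forall u, u \in N ->
    exists2 z, z \in N0 & near a z u) -> w \in layer N ->
    exists2 z, z \in N0 & near (a + r) z w.
  move=> H /layerP[/H[z zN zu]|[u /H[z zN zu] /shareP[uw _]]]; exists z => //.
    by apply: nearW zu; exact: leq_addr.
  exact: near_trans zu uw.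
rewrite mul2n -addnn; apply: (step) => u; rewrite -[r in near r]add0n.
by apply: step => z zN; exists z => //; exact: near_refl.
Qed.

Lemma leq_rM : r <= M.
Proof. by rewrite /M; nia. Qed.

Lemma N2_S : N2 \subset S.
Proof.
apply/fintype.subsetP => v /near_N2[z zN zv]; rewrite inE; apply/existsP.
by exists z; rewrite zN; apply: nearW zv; lia.
Qed.

Lemma N0_N2 : N0 \subset N2.
Proof. exact: fintype.subset_trans (layer_sub _) (layer_sub _). Qed.

Let beta' t := if t \in T' then beta t :\: S else finset.set0.

Lemma beta'P t v : v \in beta' t -> [/\ t \in T', v \in beta t & v \notin S].
Proof.
rewrite /beta'; case: ifP => tT; last by rewrite finset.in_set0.
by rewrite finset.in_setD => /andP[].
Qed.

(** The climb of a vertex outside [S] stays in [T'] and never starts at [x], whose bag is contained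
    in [S]. *)
Lemma beta'_subtree : subtree_bags t0 pi beta'.
Proof.
move=> v; have [t tv] := sb v; exists t => i /beta'P[iT vi vS].
case: (tv i vi) => [|[it0 vpi]]; [by left|right; split=> //].
have ix : i != x.
  apply: contraNneq vS => ix; rewrite ix in vi.
  exact: (fintype.subsetP N2_S _ (fintype.subsetP N0_N2 _ vi)).
have piT : pi i \in T'.
  exact: T'_up iT (desc_parent _ _) (parent_sub (T'P iT) ix).
by rewrite /beta' piT finset.in_setD vS.
Qed.

Lemma beta'_covered t : covered k M (beta' t).
Proof.
have [e0|/finset.set0Pn[v0 /beta'P[tT v0t v0S]]] := eqVneq (beta' t) finset.set0.
  by exists [::] => // v; rewrite e0 finset.in_set0.
have [v vN vt] : exists2 v, v \in N2 & v \in beta t.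
  move: tT; rewrite !inE => /andP[_ /orP[/eqP tx|/existsP[v /andP[]]]].
    case/negP: v0S; apply: (fintype.subsetP N2_S); apply: (fintype.subsetP N0_N2).
    by rewrite /N0 -tx.
  by exists v.
have [s sk Hs] := cov t; have [z zs zv] := Hs v vt.
have ps := seq.perm_to_rem zs.
exists (rem z s); first by rewrite -ltnS -[_.+1]/(size (z :: rem z s)) -(perm_size ps).
move=> u /beta'P[_ ut uS]; have [z' z's z'u] := Hs u ut.
exists z'; last exact: nearW leq_rM z'u.
move: z's; rewrite (perm_mem ps) inE => /orP[/eqP z'z|//].
case/negP: uS; rewrite inE; have [a aN av] := near_N2 vN.
apply/existsP; exists a; rewrite aN; apply: (@nearW _ (2 * r + (r + r))).
  by rewrite addnn -mul2n -mulnDl.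
apply: near_trans av _; apply: (near_trans (v := z)); first by rewrite near_sym.
by rewrite -z'z.
Qed.

(** * Gluing the upper colouring to those below *)

Section Glue.
Variables (cW : G -> bool) (cy : T -> G -> bool).
Hypothesis cWP : forall u v,
  connect (mono cW (share M beta' [set: T])) u v -> near D' u v.

(** The layers beyond the root bag get opposite constants, so no monochromatic edge leads from [N1]
    outside [N0] to the complement of [N1]. *)
Let c1 v := if v \in N0 then c0 v else
  if v \in N1 then true else if v \in N2 then false else cW v.

Hypothesis cyP : forall y, y \in C -> good y c1 (cy y).

(** The default [true] is reached only by vertices in no bag at or below [x]. *)
Let c v := if v \in V' then c1 v else
  if [pick y in C | v \in below y] is Some y then cy y v else true.

(** The scale is [M] rather than [r], so that an excursion below the upper part becomes a single
    edge ([F_adhesion]). *)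
Let F := mono c (share M beta T').
Let ey y := mono (cy y) (share r beta (sub y)).

Lemma c_V' v : v \in V' -> c v = c1 v.
Proof. by rewrite /c => ->. Qed.

(** The clauses of [c] agree on overlaps: a vertex of [V'] in [below y] lies in the bag of [y],
    where [cy y] extends [c1]. *)
Lemma c_below y v : y \in C -> v \in below y -> c v = cy y v.
Proof.
move=> yC vy; rewrite /c; case: ifPn => [vV|vV].
  have [cc1 _ _] := cyP yC; have [v_y _] := adhesion_V' yC vy vV.
  by rewrite cc1.
case: pickP => [y' /andP[y'C vy']|/(_ y)]; last by rewrite yC vy.
by rewrite (below_uniq yC y'C vy vy' vV).
Qed.

Lemma ey_below y u v : ey y u v -> v \in below y.
Proof.
move=> /andP[/shareP[_ [t [ty _ vt]]] _]; apply/belowP; exists t => //.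
by rewrite inE in ty.
Qed.

Lemma connect_below y u v : u \in below y -> connect (ey y) u v -> v \in below y.
Proof.
move=> uy /connectP[p + ->]; case/lastP: p => // p w.
by rewrite rcons_path last_rcons => /andP[_ /ey_below].
Qed.

Lemma e_cases u v : mono c e u v ->
  F u v \/ exists2 y, y \in C & [/\ u \in below y, v \in below y & ey y u v].
Proof.
move=> /andP[/shareP[uv [t [tx ut vt]]] cuv]; rewrite inE in tx.
have [tT|tT] := boolP (t \in T').
  left; rewrite /F /mono /= cuv andbT; apply/shareP; split.
    exact: nearW leq_rM uv.
  by exists t.
right; have [y yC ty] := C_cover tx tT.
have uy : u \in below y by apply/belowP; exists t.
have vy : v \in below y by apply/belowP; exists t.
exists y => //; split=> //.
rewrite /ey /mono /= -!(c_below yC) // cuv andbT; apply/shareP; split=> //.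
by exists t; rewrite inE.
Qed.

Lemma F_V' u v : F u v -> u \in V' /\ v \in V'.
Proof. by move=> /andP[/shareP[_ [t [tT ut vt]]] _]; split; apply/V'P; exists t. Qed.

Lemma F_sym : connect_sym F.
Proof. exact/sym_connect_sym/mono_sym/share_sym. Qed.

Lemma F_near u v : F u v -> near M u v.
Proof. by move=> /andP[/shareP[]]. Qed.

Lemma near_adhesion y w v : y \in C -> w \in below y -> w \in V' ->
  connect (ey y) w v -> near M w v.
Proof.
move=> yC wy wV wv; have [_ _ H] := cyP yC.
by apply: H wv; have [] := adhesion_V' yC wy wV.
Qed.

Lemma F_adhesion y w v : y \in C -> w \in below y -> w \in V' -> v \in V' ->
  connect (ey y) w v -> F w v.
Proof.
move=> yC wy wV vV wv; have vy := connect_below wy wv.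
have cwv := connect_mono wv.
rewrite /F /mono /= !(c_below yC) // cwv eqxx andbT.
apply/shareP; split; first exact: near_adhesion wv.
exists (pi y); split; first by move: yC; rewrite finset.in_set => /and3P[].
  by have [] := adhesion_V' yC wy wV.
by have [] := adhesion_V' yC vy vV.
Qed.

(* A monochromatic path from the upper part leaves it only into a subtree
   below some [y], and if it comes back, it does so within the bag of [pi y]
   and within distance [M]. *)
Lemma trace u v : u \in V' -> connect (mono c e) u v ->
  exists w, [/\ w \in V', connect F u w &
    v = w \/ exists y, [/\ y \in C, w \in below y & connect (ey y) w v]].
Proof.
move=> uV /connectP[p + ->]; elim/last_ind: p => [|p v' IH].
  by move=> _; exists u; split=> //; left.
rewrite rcons_path last_rcons; move: (last u p) IH => a IH /andP[/IH[w [wV uw Hw]] av].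
have Fa : a \in V' -> connect F u a.
  move=> aV; case: Hw => [aw|[y [yC wy wa]]]; first by rewrite aw.
  exact: connect_trans uw (connect1 (F_adhesion yC wy wV aV wa)).
case: (e_cases av) => [Fav|[y yC [ay v'y yav]]].
  have [aV v'V] := F_V' Fav; exists v'; split=> //; last by left.
  exact: connect_trans (Fa aV) (connect1 Fav).
have [aV|aV] := boolP (a \in V').
  exists a; split=> //; first exact: Fa.
  by right; exists y; split=> //; exact: connect1.
case: Hw => [aw|[y' [y'C wy' wa]]]; first by rewrite aw wV in aV.
have yy' : y = y' by apply: below_uniq ay (connect_below wy' wa) aV.
exists w; split=> //; right; exists y'; split=> //.
by apply: connect_trans wa _; rewrite -yy'; exact: connect1.
Qed.

Lemma trace_near u v : u \in V' -> connect (mono c e) u v ->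
  exists w, [/\ w \in V', connect F u w & near M w v].
Proof.
move=> uV /(trace uV)[w [wV uw [->|[y [yC wy wv]]]]]; exists w; split=> //.
  by apply: nearW (near_refl 0 _).
exact: near_adhesion wv.
Qed.

Let E' := mono cW (share M beta' [set: T]).

Lemma F_W u v : F u v -> u \notin S -> v \notin S -> E' u v.
Proof.
move=> Fuv uS vS; have [uV vV] := F_V' Fuv.
have c1W a : a \notin S -> c1 a = cW a.
  move=> aS; have aN : a \notin N2 by apply: contraNN aS => /(fintype.subsetP N2_S).
  rewrite /c1 (negPf aN).
  have /negPf-> : a \notin N0 by apply: contraNN aN => /(fintype.subsetP N0_N2).
  by have /negPf-> : a \notin N1 by apply: contraNN aN => /(fintype.subsetP (layer_sub _)).
case/andP: Fuv => /shareP[uvM [t [tT ut vt]]].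
rewrite (c_V' uV) (c_V' vV) !c1W // => cuv; rewrite /E' /mono /= cuv andbT.
apply/shareP; split=> //; exists t.
by rewrite /beta' tT !finset.in_setD uS vS ut vt inE.
Qed.

(** Before it first enters [S], the walk uses only edges of [E'] and stays within [D']. One step of
    length [M] enters [S], and [4 * r] leads back to the root bag. *)
Lemma F_escape u s : connect F u s -> s \in S ->
  exists2 z, z \in N0 & near (4 * r + M + D') z u.
Proof.
move=> us sS.
suff [w uw [s' s'S ws']] : exists2 w, connect E' u w &
    exists2 s', s' \in S & near M w s'.
  move: s'S; rewrite inE => /existsP[z /andP[zN zs']]; exists z => //.
  apply: (near_trans (v := w)); last by rewrite near_sym; exact: cWP.
  by apply: near_trans zs' _; rewrite near_sym.
case/connectP: us sS => p + ->; elim: p u => [|v p IH] u /=.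
  move=> _ uS; exists u => //; exists u => //; exact: nearW (near_refl 0 _).
move=> /andP[uv vp] sS; have [w vw ws'] := IH v vp sS.
have [uS|uS] := boolP (u \in S).
  by exists u => //; exists u => //; exact: nearW (near_refl 0 _).
have [vS|vS] := boolP (v \in S).
  by exists u => //; exists v => //; exact: F_near.
by exists w => //; exact: connect_trans (connect1 (F_W uv uS vS)) vw.
Qed.

(** A component meeting [S] stays around the root bag, hence in [k.+1] balls; one that avoids [S] is
    connected in [E'] by [F_W]. *)
Lemma F_bounded u v : connect F u v -> near D1 u v.
Proof.
move=> uv; have [/existsP[s /andP[sS us]]|nS] :=
    boolP [exists s in S, connect F u s].
  pose K := [set w | connect F u w].
  have cK : covered k.+1 (r + (4 * r + M + D')) K.
    apply: covered_near (cov x) _ => w; rewrite inE => uw.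
    by apply: F_escape sS; apply: connect_trans us; rewrite F_sym.
  apply: nearW (connect_near F_near cK _ uv); last by move=> w; rewrite inE.
  by rewrite /D1; nia.
apply: (@nearW _ D'); first exact: leq_addr.
apply: cWP; case/connectP: uv => p + ->.
have uS w : connect F u w -> w \notin S.
  by move=> uw; apply: contraNN nS => wS; apply/existsP; exists w; rewrite wS.
elim/last_ind: p => // p w IH; rewrite rcons_path last_rcons => /andP[up pw].
have uz : connect F u (last u p) by apply/connectP; exists p.
apply: connect_trans (IH up) (connect1 (F_W pw (uS _ uz) (uS _ _))).
exact: connect_trans uz (connect1 pw).
Qed.

Lemma c_N1 u v : u \in N1 -> mono c e u v -> v \in N1.
Proof.
have NV w : w \in N2 -> w \in V'.
  move=> wN; suff [s sx ws] : exists2 s, desc s x & w \in beta s.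
    apply/V'P; exists s => //; rewrite !inE sx; apply/orP; right.
    by apply/existsP; exists w; rewrite wN.
  have lay (N : {set G}) : (forall w, w \in N -> exists2 s, desc s x & w \in beta s) ->
      forall w, w \in layer N -> exists2 s, desc s x & w \in beta s.
    move=> H a /layerP[/H//|[z zN /shareP[_ [s [sx _ ws]]]]]; exists s => //.
    by rewrite inE in sx.
  apply: (lay _ _ _ wN) => a; apply: lay => b bN; exists x => //.
  exact: desc_refl.
move=> uN1 /andP[uv /eqP cuv].
have [uN0|uN0] := boolP (u \in N0); first exact: layer_edge uv.
have vN2 : v \in N2 by exact: layer_edge uv.
apply/negPn/negP => vN1.
have vN0 : v \notin N0 by apply: contraNN vN1 => /(fintype.subsetP (layer_sub _)).
move: cuv; rewrite !c_V' ?NV //; last exact: (fintype.subsetP (layer_sub _)).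
by rewrite /c1 (negPf uN0) (negPf vN0) uN1 (negPf vN1) vN2.
Qed.

Lemma glue_good : good x c0 c.
Proof.
have e_near a b : mono c e a b -> near r a b by move=> /andP[/shareP[]].
have e_sym : connect_sym (mono c e) by exact/sym_connect_sym/mono_sym/share_sym.
split.
- move=> v vN; rewrite c_V'; last exact: (fintype.subsetP N0_T').
  by rewrite /c1 vN.
- move=> u v uv.
  (* A component meeting the upper part is traced back to it from both ends; any other is a single
     vertex or lies below a single node of [C]. *)
  have [/existsP[a /andP[aV ua]]|nV] := boolP [exists a in V', connect (mono c e) u a].
    have au : connect (mono c e) a u by rewrite e_sym.
    have [w [wV aw wu]] := trace_near aV au.
    have [w' [w'V aw' w'v]] := trace_near aV (connect_trans au uv).
    apply: near_trans w'v; apply: (near_trans (v := w)); first by rewrite near_sym.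
    by apply: F_bounded; apply: connect_trans aw'; rewrite F_sym.
  have uV w : connect (mono c e) u w -> w \notin V'.
    by move=> uw; apply: contraNN nV => wV; apply/existsP; exists w; rewrite wV.
  suff [->|[y yC [uy {}uv]]] :
      u = v \/ exists2 y, y \in C & u \in below y /\ connect (ey y) u v.
  + by apply: nearW (near_refl 0 _).
  + by have [_ + _] := cyP yC; apply.
  case/connectP: uv => p + ->; elim/last_ind: p => [|p w IH]; first by left.
  rewrite rcons_path last_rcons => /andP[up pw]; right.
  have ua : connect (mono c e) u (last u p) by apply/connectP; exists p.
  case: (e_cases pw) => [/F_V'[aV _]|[y yC [ay wy yaw]]].
    by have := uV _ ua; rewrite aV.
  case: (IH up) => [<-|[y' y'C [uy' y'ua]]] in ay yaw *.
    by exists y => //; split=> //; exact: connect1.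
  have yy' := below_uniq yC y'C ay (connect_below uy' y'ua) (uV _ ua).
  rewrite yy' in yaw; exists y' => //; split=> //.
  exact: connect_trans y'ua (connect1 yaw).
- move=> u v uN uv.
  (* By [c_N1] the component cannot leave [N1], which the balls of the root bag cover once enlarged
     by [r]. *)
  have cK : covered k.+1 (r + r) N1.
    apply: covered_near (cov x) _ => w /layerP[wN|[z zN /shareP[zw _]]].
      by exists w => //; exact: nearW (near_refl 0 _).
    by exists z.
  apply: nearW (connect_near e_near cK _ uv); first by rewrite /M; nia.
  move=> w /connectP[p + ->]; have: u \in N1 by exact: (fintype.subsetP (layer_sub _)).
  elim: p u {uv uN} => //= a p IH u uN1 /andP[ua ap].
  by apply: IH ap; exact: c_N1 ua.
Qed.

End Glue.

Lemma extend_node : exists c, good x c0 c.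
Proof.
have [cW cWP] := colour_fewer beta'_subtree beta'_covered.
set c1 := fun v => if v \in N0 then c0 v else
  if v \in N1 then true else if v \in N2 then false else cW v.
have /boolp.choice[cy cyP] y : exists c, y \in C -> good y c1 c.
  have [yC|_] := boolP (y \in C); last by exists c0.
  by have [c] := extend_below (C_desc yC) (C_neq yC) c1; exists c.
eexists; exact: (glue_good cWP cyP).
Qed.

End Node.

Lemma extend x c0 : exists c, good x c0 c.
Proof.
have [n] := ubnP #|sub x|; elim: n x c0 => // n IH x c0 xn.
apply: extend_node => y yx ne c0'; apply: IH.
apply: leq_trans (proper_card _) _; last exact: xn.
apply/fintype.properP; split.
  by apply/fintype.subsetP => s; rewrite !inE => sy; exact: desc_trans yx.
exists x; rewrite inE; first exact: desc_refl.
by apply: contraNN ne => xy; rewrite (desc_anti rT yx xy).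
Qed.

Lemma colour_step : exists c : G -> bool, forall u v,
  connect (mono c (share r beta [set: T])) u v -> near D u v.
Proof.
have [c [_ H _]] := extend t0 (fun=> true); exists c => u v uv; apply: H.
suff -> : sub t0 = [set: T] by [].
by apply/finset.setP => t; rewrite !inE (desc_root rT).
Qed.

End Extend.

Lemma coarse_treewidth_colouring k r : exists D, forall (G : sgraph)
    (T : finType) (t0 : T) pi h (beta : T -> {set G}),
  rooted t0 pi h -> subtree_bags t0 pi beta ->
  (forall t, covered k r (beta t)) ->
  exists c : G -> bool, forall u v,
    connect (mono c (share r beta [set: T])) u v -> near D u v.
Proof.
elim: k r => [|k IH] r.
  (* With no balls all bags are empty, so the coarse graph has no edges. *)
  exists 0 => G T t0 pi h beta _ _ cov; exists (fun=> true) => u v.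
  case/connectP => -[|w p] /=; first by move=> _ ->; exact: near_refl.
  case/andP => /andP[/shareP[_ [t [_ ut _]]] _] _ _.
  by have [[|//] _ /(_ u ut)[]] := cov t.
(* The smaller instance has the constant [M] of [Extend] both as covering radius and as scale. *)
have [D' HD'] := IH (k.+1 * (5 * r)).
eexists => G T t0 pi h beta rT sb cov.
by apply: (colour_step rT sb cov) => beta'; exact: (HD' _ _ _ _ _ _ rT).
Qed.

(** * Tree-decompositions of powers from a placement of the vertices on a tree *)

Section Hull.
Variables (G : sgraph) (T : finType) (t0 : T) (pi : T -> T) (h : T -> nat).
Variables (tau : G -> T) (m : nat).
Hypothesis rT : rooted t0 pi h.

Local Notation desc := (desc pi).

Lemma child_above i j : desc i j -> i != j ->
  exists l, [/\ l != t0, pi l = j & desc i l].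
Proof.
have [n] := ubnP (h i); elim: n i => // n IH i hi ij ne.
have it0 : i != t0.
  apply: contraNneq ne => it0; rewrite it0 in ij *.
  by rewrite (desc_anti rT ij (desc_root rT j)).
have [pij|pij] := eqVneq (pi i) j; first by exists i; split=> //; exact: desc_refl.
have [|l [lt0 pl il]] := IH (pi i) _ (parent_sub ij ne) pij.
  exact: leq_trans (rT.2 _ it0) _.
by exists l; split=> //; apply: desc_trans il; exact: desc_parent.
Qed.

(* [v] is in the bag of [i] iff [i] lies in the subtree spanned by the images
   under [tau] of the vertices at distance at most [m] from [v]. *)
Definition hull_bag (i : T) : {set G} :=
  [set v | [exists w, near m v w && desc (tau w) i] &&
    [forall j, [&& j != t0 & pi j == i] ==>
      [exists w, near m v w && ~~ desc (tau w) j]]].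

Lemma hull_bagP i v : reflect
  ((exists2 w, near m v w & desc (tau w) i) /\
   forall j, j != t0 -> pi j = i -> exists2 w, near m v w & ~~ desc (tau w) j)
  (v \in hull_bag i).
Proof.
rewrite inE; apply: (iffP andP) => -[].
  move=> /existsP[w /andP[vw wi]] H; split; first by exists w.
  move=> j jt0 pj; have := forallP H j; rewrite jt0 pj eqxx /=.
  by move=> /existsP[w' /andP[]]; exists w'.
move=> [w vw wi] H; split; first by apply/existsP; exists w; rewrite vw.
apply/forallP => j; apply/implyP => /andP[jt0 /eqP pj].
by have [w' vw' w'j] := H j jt0 pj; apply/existsP; exists w'; rewrite vw'.
Qed.

(** The topmost node is the one with all images of the ball around [v] below it. At any other node
    of [v] some image is not below, and this image witnesses that the parent belongs to the hull
    too. *)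
Lemma hull_bag_subtree : subtree_bags t0 pi hull_bag.
Proof.
move=> v; pose all_below i := [forall w, near m v w ==> desc (tau w) i].
have uniq_top i i' : v \in hull_bag i -> all_below i ->
    v \in hull_bag i' -> all_below i' -> i = i'.
  move=> vi ai vi' ai'; case/hull_bagP: (vi) => -[w vw wi] _.
  have wi' := implyP (forallP ai' w) vw.
  wlog i'i : i i' ai ai' vi vi' wi wi' / desc i' i.
    move=> H; case: (desc_chain wi wi') => ii'; last exact: H.
    by apply/esym/H.
  apply/eqP/negPn/negP; rewrite eq_sym => ne.
  have [j [jt0 pj i'j]] := child_above i'i ne.
  case/hull_bagP: vi => _ /(_ j jt0 pj)[w' vw' /negP]; apply.
  exact: desc_trans (implyP (forallP ai' w') vw') i'j.
exists (odflt t0 [pick i | (v \in hull_bag i) && all_below i]) => i vi.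
have [ai|] := boolP (all_below i).
  left; case: pickP => [i' /andP[vi' ai']|/(_ i)] /=; first exact: uniq_top.
  by rewrite vi ai.
rewrite negb_forall => /existsP[w']; rewrite negb_imply => /andP[vw' w'i].
have it0 : i != t0 by apply: contraNneq w'i => ->; exact: desc_root rT _.
right; split=> //.
case/hull_bagP: vi => -[w vw wi] _; apply/hull_bagP; split.
  by exists w => //; apply: desc_trans wi _; exact: desc_parent.
move=> j jt0 pj; have [wj|wj] := boolP (desc (tau w) j); last by exists w.
exists w' => //; apply: contra w'i => w'j; suff <- : j = i by [].
have parentN l l' : l != t0 -> l' != t0 -> pi l = pi l' -> desc l l' -> l = l'.
  move=> lt0 l't0 pll ll'; apply/eqP/negPn/negP => ne.
  have := parent_sub ll' ne; rewrite pll => pl'.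
  by have := desc_parentN rT l't0; rewrite pl'.
by case: (desc_chain wj wi) => ?; [|apply/esym]; apply: parentN.
Qed.

Lemma hull_bag_tau u v : near m u v -> v \in hull_bag (tau u).
Proof.
rewrite near_sym => vu; apply/hull_bagP; split.
  by exists u => //; exact: desc_refl.
by move=> j jt0 pj; exists u => //; rewrite -pj; exact: (desc_parentN rT jt0).
Qed.

Lemma hull_bag_cross i v : v \in hull_bag i ->
  (exists2 w, near m v w & tau w = i) \/
  exists2 j, j != t0 /\ pi j = i & exists a b,
    [/\ adj a b, desc (tau a) j, ~~ desc (tau b) j, near m v a & near m v b].
Proof.
move=> /hull_bagP[[w vw wi] H]; have [<-|ne] := eqVneq (tau w) i.
  by left; exists w.
have [j [jt0 pj wj]] := child_above wi ne; right; exists j => //.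
have [w' vw' w'j] := H j jt0 pj.
exact: (near_cross (P := fun u => desc (tau u) j) vw vw' wj w'j).
Qed.

End Hull.

Definition two_colourable m D (G : sgraph) : Prop := exists c : G -> bool,
  forall u v, connect (mono c (near m)) u v -> near D u v.

Lemma hull_colouring k r m : exists D, forall (G : sgraph) (T : finType)
    (t0 : T) pi h (tau : G -> T),
  rooted t0 pi h -> (forall i, covered k r (hull_bag t0 pi tau m i)) ->
  two_colourable m D G.
Proof.
(* One parameter serves as covering radius and as scale, so it must be at least [r] and at least
   [m]. *)
have [D HD] := coarse_treewidth_colouring k (r + m); exists D.
move=> G T t0 pi h tau rT cov.
have [|c cP] := HD _ _ _ _ _ _ rT (hull_bag_subtree tau m rT).
  move=> t; apply: coveredW (cov t) => //; exact: leq_addr.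
exists c => u v uv; apply: cP; apply: connect_sub uv => a b /andP[ab cab].
apply: connect1; rewrite /mono /= cab andbT; apply/shareP; split.
  by apply: nearW ab; exact: leq_addl.
exists (tau a); split; first exact: finset.in_setT; apply: (hull_bag_tau _ rT) => //.
by apply: nearW (near_refl 0 _).
Qed.

(** * Rooting a tree given as a graph *)

Section RootingTrees.
Variable T : sgraph.

Lemma set2_eq (a b x y : T) : [set a; b] = [set x; y] :> {set T} ->
  (a = x /\ b = y) \/ (a = y /\ b = x).
Proof.
move=> /finset.setP E; have := (E a, E b, E x, E y).
rewrite !inE !eqxx ?orbT /= => -[[[/esym + /esym]]].
by case/orP=> /eqP-> /orP[]/eqP->; rewrite ?eqxx ?orbb /= => /eqP + /eqP;
  (try by left); (try by right); move=> ? ?; left.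
Qed.

Lemma edge_deleted_sym (x y : T) : symmetric (edge_deleted x y).
Proof. by move=> a b; rewrite /edge_deleted /= adj_sym finset.setUC. Qed.

Lemma acyclic_bridge (x y : T) : acyclic T -> adj x y ->
  ~~ connect (edge_deleted x y) x y.
Proof.
move=> aT xy; apply/negP => /connectP[p0 pp0]; case/shortenP: pp0 => p pp up _ Ey.
apply: (aT (x :: p)).
  case: p pp Ey {up} => [|z [|z' p]] //=; first by move=> _ Ey; rewrite Ey adj_irr in xy.
  by move=> + Ey; rewrite Ey /edge_deleted /= eqxx andbF.
rewrite /ucycle up andbT /= rcons_path -Ey adj_sym xy andbT.
by apply: sub_path pp => a b /andP[].
Qed.

Lemma tree_rooted : is_tree T -> exists (t0 : T) pi h,
  [/\ rooted t0 pi h, forall i, i != t0 -> adj i (pi i) &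
    forall i j, adj i j -> (i != t0 /\ pi i = j) \/ (j != t0 /\ pi j = i)].
Proof.
move=> [[[t0 _] conT] aT]; exists t0.
have /boolp.choice[h hP] i : exists n, near n t0 i /\ forall m, near m t0 i -> n <= m.
  have [n ni] : exists n, near n t0 i.
    have /connectP[p pp ->] := conT t0 i (finset.in_setT _) (finset.in_setT _).
    exists (size p); apply/asboolP; exists p; split=> //.
    by apply: sub_path pp => a b /and3P[].
  by have [//|n' n'i min] := @ex_minnP (fun n => near n t0 i); [exists n|exists n'].
have /boolp.choice[pi piP] i : exists j,
    (i = t0 /\ j = t0) \/ [/\ i != t0, adj i j & h j < h i].
  have [->|it0] := eqVneq i t0; first by exists t0; left.
  have [+ min] := hP i; case Eh: (h i) => [|n].
    by move=> /near_eq0 ti; rewrite ti eqxx in it0.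
  move=> /nearS[ti|[j tj ji]]; first by rewrite ti eqxx in it0.
  exists j; right; split=> //; first by rewrite adj_sym.
  by have [_ /(_ _ tj)] := hP j.
have rT : rooted t0 pi h.
  split; first by case: (piP t0) => [[]//|[]]; rewrite eqxx.
  by move=> i it0; case: (piP i) => [[ii]|[]//]; rewrite ii eqxx in it0.
have adjpi i : i != t0 -> adj i (pi i).
  by move=> it0; case: (piP i) => [[ii]|[]//]; rewrite ii eqxx in it0.
exists pi, h; split=> // i j ij.
have [/andP[it0 /eqP ppi]|Ni] := boolP ((i != t0) && (pi i == j)); first by left.
have [/andP[jt0 /eqP ppj]|Nj] := boolP ((j != t0) && (pi j == i)); first by right.
(* If neither end of the edge were the parent of the other, both would climb to the root without
   using it, contradicting [acyclic_bridge]. *)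
have to_root s : connect (edge_deleted i j) s t0.
  have [n] := ubnP (h s); elim: n s => // n IH s hs.
  have [->|st0] := eqVneq s t0; first exact: connect0.
  apply: connect_trans (IH (pi s) _); last exact: leq_trans (rT.2 _ st0) _.
  apply: connect1; rewrite /edge_deleted /= adjpi //=.
  apply/negP => /eqP/set2_eq[[si pj]|[sj pj]].
    by move: Ni; rewrite -si st0 pj eqxx.
  by move: Nj; rewrite -sj st0 pj eqxx.
have := acyclic_bridge aT ij; rewrite (connect_trans (to_root i)) //.
by rewrite (sym_connect_sym (edge_deleted_sym i j)).
Qed.

Variables (t0 : T) (pi : T -> T) (h : T -> nat).
Hypothesis rT : rooted t0 pi h.
Hypothesis adj_parent : forall i, i != t0 -> adj i (pi i).
Hypothesis adj_cases : forall i j, adj i j ->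
  (i != t0 /\ pi i = j) \/ (j != t0 /\ pi j = i).

(** This turns [branch_side] at the edge above [j] into the set of vertices placed below [j]. *)
Lemma connect_edge_deleted j s : j != t0 ->
  connect (edge_deleted j (pi j)) j s = desc pi s j.
Proof.
move=> jt0; apply/idP/idP.
  case/connectP=> p + ->; elim/last_ind: p => [|p b IH]; first by rewrite desc_refl.
  rewrite rcons_path last_rcons => /andP[/IH aj /andP[ab nab]].
  case: (adj_cases ab) => -[ne E].
    rewrite -E; apply: parent_sub => //; apply: contra nab => /eqP Ea.
    by rewrite -E Ea.
  by apply: desc_trans aj; rewrite -E; exact: desc_parent.
rewrite (sym_connect_sym (edge_deleted_sym _ _)).
have [n] := ubnP (h s); elim: n s => // n IH s hs sj.
have [->|ne] := eqVneq s j; first exact: connect0.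
have st0 : s != t0.
  apply: contraNneq ne => st0; rewrite st0 in sj *.
  by rewrite (desc_anti rT sj (desc_root rT j)).
apply: connect_trans (IH (pi s) _ (parent_sub sj ne)); last first.
  exact: leq_trans (rT.2 _ st0) _.
apply: connect1; rewrite /edge_deleted /= adj_parent //=.
apply/negP => /eqP/set2_eq[[sj' _]|[spj psj]]; first by rewrite sj' eqxx in ne.
by move: sj (desc_parentN rT jt0); rewrite spj => ->.
Qed.

Lemma card_children i : #|[set j | (j != t0) && (pi j == i)]| <= degree i.
Proof.
apply/subset_leq_card/fintype.subsetP => j; rewrite !inE => /andP[jt0 /eqP<-].
by rewrite adj_sym adj_parent.
Qed.

Lemma connected_set_separate (X : {set T}) i s s' : connected_set X ->
  s \in X -> desc pi s i -> s' \in X -> ~~ desc pi s' i ->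
  i \in X /\ pi i \in X.
Proof.
move=> [_ conX] sX + s'X; have /connectP[p + ->] := conX s s' sX s'X.
elim: p s {sX} => [|b p IH] s /=; first by move=> _ ->.
move=> /andP[/and3P[sX bX sb] bp] si s'i.
have [bi|bi] := boolP (desc pi b i); first exact: IH bp bi s'i.
case: (adj_cases sb) => -[ne E].
  have [Es|Es] := eqVneq s i; first by rewrite -Es E.
  by case/negP: bi; rewrite -E; exact: parent_sub.
by case/negP: bi; apply: desc_trans si; rewrite -E; exact: desc_parent.
Qed.

End RootingTrees.

(** * Tree independence number and sim-width *)

Lemma alpha_covered (G : sgraph) (X : {set G}) k :
  alpha X <= k -> covered k 1 X.
Proof.
move=> aX; pose P (S : {set G}) := (S \subset X) && stable S.
have P0 : P finset.set0.
  by rewrite /P finset.sub0set; apply/forallP => x; rewrite finset.in_set0.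
case: (arg_maxnP (fun S : {set G} => #|S|) P0) => S /andP[SX stS] Smax.
exists (enum S).
  by rewrite -cardE; apply: leq_trans aX; apply: leq_bigmax_cond; rewrite SX.
move=> v vX; have [vS|vS] := boolP (v \in S).
  by exists v; rewrite ?mem_enum //; apply: nearW (near_refl 0 _).
have [/existsP[z /andP[zS zv]]|nz] := boolP [exists z in S, adj z v].
  by exists z; rewrite ?mem_enum //; exact: near_adj.
have nadj z : z \in S -> ~~ adj z v.
  by move=> zS; apply: contraNN nz => zv; apply/existsP; exists z; rewrite zS.
have PvS : P (v |: S).
  rewrite /P finset.subUset finset.sub1set vX SX; apply/forall_inP => x xvS.
  apply/forall_inP => y; move: xvS; rewrite !finset.in_setU1.
  case/orP=> [/eqP->|xS] /orP[/eqP->|yS]; first by rewrite adj_irr.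
  - by rewrite adj_sym nadj.
  - exact: nadj.
  - exact: (forall_inP (forall_inP stS x xS) y yS).
by have := Smax _ PvS; rewrite /= cardsU1 vS ltnn.
Qed.

Lemma edgesP (G : sgraph) (e : {set G}) :
  reflect (exists x y, adj x y /\ e = [set x; y]) (e \in edges G).
Proof.
rewrite inE; apply: (iffP existsP) => -[x].
  by move=> /existsP[y /andP[xy /eqP->]]; exists x, y.
by move=> [y [xy ->]]; exists x; apply/existsP; exists y; rewrite xy eqxx.
Qed.

Lemma edges_cutP (G : sgraph) (A e : {set G}) : e \in edges (cut_graph A) ->
  exists a b, [/\ adj a b, a \in A, b \notin A & e = [set a; b]].
Proof.
move=> /edgesP[x [y [/andP[xy Axy] ->]]].
have [xA|xA] := boolP (x \in A).
  by exists x, y; split=> //; move: Axy; rewrite xA; case: (y \in A).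
exists y, x; split=> //; first by rewrite adj_sym.
  by move: Axy; rewrite (negPf xA); case: (y \in A).
exact: finset.setUC.
Qed.

Lemma edges_cut_sub (G : sgraph) (A : {set G}) :
  edges (cut_graph A) \subset edges G.
Proof.
apply/fintype.subsetP => e /(@edges_cutP G A)[a [b [ab _ _ ->]]].
by apply/edgesP; exists a, b.
Qed.

Lemma cut_sim_covered (G : sgraph) (A B : {set G}) k m : cut_sim A <= k ->
  (forall v, v \in B -> exists a b,
    [/\ adj a b, a \in A, b \notin A, near m v a & near m v b]) ->
  covered k (m + 2) B.
Proof.
move=> simA HB.
pose P (M : {set {set G}}) := induced_matching M && (M \subset edges (cut_graph A)).
have P0 : P finset.set0.
  rewrite /P /induced_matching !finset.sub0set /= andbT; apply/andP; split.
    by apply/finset.trivIsetP => X Y; rewrite finset.in_set0.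
  apply/forall_inP => e /edgesP[x [y [_ ->]]]; apply/implyP => /fintype.subsetP.
  move=> /(_ x); rewrite finset.in_set2 eqxx => /(_ isT)/finset.bigcupP[X].
  by rewrite finset.in_set0.
case: (arg_maxnP (fun M : {set {set G}} => #|M|) P0) => M PM Mmax.
have MA := PM; case/andP: MA => /and3P[ME Mtriv Mind] MA.
(* One end of each matching edge serves as centre. The extra radius [2] is one step to an end of a
   matching edge and one more to its chosen end. *)
exists (pmap (fun e : {set G} => [pick z in e]) (enum M)).
  rewrite size_pmap; apply: leq_trans (count_size _ _) _; rewrite -cardE.
  by apply: leq_trans simA; apply: leq_bigmax_cond.
move=> v /HB[a [b [ab aA bA va vb]]].
suff [e eM [c ce vc]] : exists2 e, e \in M & exists2 c, c \in e & near (m + 1) v c.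
  have [x [y [xy Ee]]] := edgesP _ (fintype.subsetP ME e eM).
  have [z ze Ez] : exists2 z, z \in e & [pick z in e] = Some z.
    by case: pickP => [z ze|/(_ c)]; [exists z|rewrite ce].
  exists z; first by rewrite mem_pmap -Ez; apply: map_f; rewrite mem_enum.
  rewrite near_sym -[2]/(1 + 1) addnA; apply: near_trans vc _.
  move: ce ze; rewrite Ee !finset.in_set2.
  have n1 u : near 1 u u by apply: nearW (near_refl 0 _).
  by case/orP=> /eqP-> /orP[] /eqP->; rewrite ?n1 // ?[near _ y x]near_sym near_adj.
(* Otherwise [a] and [b] are distinct from and not adjacent to all matched vertices, so adding the
   edge between them contradicts the maximality of [M]. *)
apply: contrapT => nM.
have far c : c \in finset.cover M -> [/\ c != a, c != b, ~~ adj a c & ~~ adj b c].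
  move=> /finset.bigcupP[e eM ce]; split; apply/negP => H; apply: nM; exists e => //;
    exists c => //.
  - by rewrite (eqP H); apply: nearW va; exact: leq_addr.
  - by rewrite (eqP H); apply: nearW vb; exact: leq_addr.
  - exact: near_trans va (near_adj H).
  - exact: near_trans vb (near_adj H).
pose e0 : {set G} := [set a; b].
have e0E : e0 \in edges G by apply/edgesP; exists a, b.
have e0far u c : u \in e0 -> c \in finset.cover M -> (c == u = false) * (adj u c = false).
  rewrite finset.in_set2 => /orP[]/eqP-> /far[/negPf ca /negPf cb /negPf ac /negPf bc].
    by rewrite ca ac.
  by rewrite cb bc.
have e0M : e0 \notin M.
  apply/negP => eM; have ae : a \in e0 by rewrite finset.in_set2 eqxx.
  have aM : a \in finset.cover M by apply/finset.bigcupP; exists e0.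
  by have [] := e0far a a ae aM; rewrite eqxx.
have coverE c : c \in finset.cover (e0 |: M) -> c \in e0 \/ c \in finset.cover M.
  move=> /finset.bigcupP[e]; rewrite finset.in_setU1 => /orP[/eqP->|eM ce]; first by left.
  by right; apply/finset.bigcupP; exists e.
suff PM' : P (e0 |: M) by have := Mmax _ PM'; rewrite /= cardsU1 e0M ltnn.
apply/andP; split; last first.
  rewrite finset.subUset finset.sub1set MA andbT; apply/(@edgesP (cut_graph A)); exists a, b.
  by split=> //=; rewrite /cut_adj /= ab aA (negPf bA).
apply/and3P; split.
- by rewrite finset.subUset finset.sub1set e0E ME.
- apply/finset.trivIsetP => X Y; rewrite !finset.in_setU1.
  have dis Z : Z \in M -> [disjoint e0 & Z].
    move=> ZM; rewrite disjoint_subset; apply/fintype.subsetP => u ue0.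
    apply/negP => uZ; have uM : u \in finset.cover M by apply/finset.bigcupP; exists Z.
    by have [] := e0far u u ue0 uM; rewrite eqxx.
  case/orP=> [/eqP->|XM] /orP[/eqP->|YM]; first by rewrite eqxx.
  + by move=> _; exact: dis.
  + by move=> _; rewrite disjoint_sym; exact: dis.
  + by move: X Y XM YM; exact/finset.trivIsetP.
- apply/forall_inP => e eE; apply/implyP => /fintype.subsetP esub.
  have [x [y [xy Ee]]] := edgesP _ eE.
  have xe : x \in e by rewrite Ee finset.in_set2 eqxx.
  have ye : y \in e by rewrite Ee finset.in_set2 eqxx orbT.
  rewrite finset.in_setU1; case: (coverE _ (esub _ xe)) (coverE _ (esub _ ye)).
  + move=> xe0 [ye0|yM]; last by have [_] := e0far x y xe0 yM; rewrite xy.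
    apply/orP; left; move: xe0 ye0 xy.
    rewrite Ee !finset.in_set2 => /orP[]/eqP-> /orP[]/eqP->; rewrite ?adj_irr // => _.
    by rewrite /e0 finset.setUC eqxx.
  + move=> xM [ye0|yM].
      by have [_] := e0far y x ye0 xM; rewrite adj_sym xy.
    apply/orP; right; apply: (implyP (forall_inP Mind e eE)).
    rewrite Ee finset.subUset !finset.sub1set xM yM //.
Qed.

Lemma cut_sim_mim (G : sgraph) (A : {set G}) : cut_sim A <= cut_mim A.
Proof.
apply/bigmax_leqP => M /andP[/and3P[ME Mtriv Mind] MA].
apply: (@leq_bigmax_cond _ _ (fun M : {set {set cut_graph A}} => #|M|)).
apply/and3P; split=> //; apply/forall_inP => e eA.
exact: (forall_inP Mind e (fintype.subsetP (edges_cut_sub A) e eA)).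
Qed.

(** The rows and columns of the matched vertices form an identity submatrix. *)
Lemma cut_mim_rank (G : sgraph) (A : {set G}) : cut_mim A <= cut_rank A.
Proof.
apply/bigmax_leqP => M /and3P[/fintype.subsetP ME /finset.trivIsetP Mtriv /forall_inP Mind].
have /boolp.choice[pq pqP] (i : 'I_#|M|) : exists pq : 'I_#|A| * 'I_#|~: A|,
    adj (enum_val pq.1) (enum_val pq.2) /\
    enum_val i = [set enum_val pq.1; enum_val pq.2].
  have [a [b [ab aA bA ->]]] := @edges_cutP G A _ (ME _ (enum_valP i)).
  have bA' : b \in ~: A by rewrite finset.in_setC.
  exists (enum_rank_in aA a, enum_rank_in bA' b) => /=.
  by rewrite !enum_rankK_in.
rewrite /cut_rank; set X := (\matrix_(i, j) _)%R.
have -> : #|M| = \rank (mxsub (fun i => (pq i).1) (fun j => (pq j).2) X).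
  rewrite -[LHS](mxrank1 'F_2); congr (\rank _); apply/matrixP => i j.
  rewrite !mxE; congr (_%:R)%R; congr nat_of_bool.
  have [<-|ne] := eqVneq i j; first by have [->] := pqP i.
  (* An off-diagonal [1] would be a cut edge between matched vertices, hence in [M]; meeting the
     edges of both [i] and [j], it would equal both. *)
  apply/esym/negP => ab; case/eqP: ne; apply: enum_val_inj.
  have [_ Ei] := pqP i; have [_ Ej] := pqP j.
  move: Ei Ej ab; set a := enum_val (pq i).1; set b := enum_val (pq j).2 => Ei Ej ab.
  pose e : {set cut_graph A} := [set a; b].
  have ai : a \in enum_val i by rewrite Ei finset.in_set2 eqxx.
  have bj : b \in enum_val j by rewrite Ej finset.in_set2 eqxx orbT.
  have ae : a \in e by rewrite finset.in_set2 eqxx.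
  have be : b \in e by rewrite finset.in_set2 eqxx orbT.
  have eM : e \in M.
    apply: (implyP (Mind e _)).
      apply/edgesP; exists a, b; split=> //=; rewrite /cut_adj /= ab.
      have aA : a \in A := enum_valP _.
      by have := enum_valP (pq j).2; rewrite -/b finset.in_setC aA => /negPf->.
    rewrite finset.subUset !finset.sub1set; apply/andP; split;
      apply/finset.bigcupP; [exists (enum_val i)|exists (enum_val j)] => //;
      exact: enum_valP.
  have meet (Y Z : {set cut_graph A}) c :
      Y \in M -> Z \in M -> c \in Y -> c \in Z -> Y = Z.
    move=> YM ZM cY cZ; apply/eqP/negPn/negP => /(Mtriv _ _ YM ZM).
    by rewrite disjoint_subset => /fintype.subsetP/(_ c cY); rewrite inE /= cZ.
  rewrite -(meet _ _ _ eM (enum_valP i) ae ai).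
  exact: meet eM (enum_valP j) be bj.
rewrite mxsubrc; apply: leq_trans (mxrankS (rowsub_sub _ _)) _.
by rewrite -[X in colsub _ X]mulmx1 -mulmx_colsub mxrankM_maxl.
Qed.

Lemma tree_alpha_colouring k m : exists D, forall (G T : sgraph)
    (beta : T -> {set G}),
  tree_decomposition beta -> (forall x, alpha (beta x) <= k) ->
  two_colourable m D G.
Proof.
have [D HD] := hull_colouring k (1 + m) m; exists D => G T beta.
move=> [treeT edgeT conT] alphaT.
have [t0 [pi [h [rT _ adjT]]]] := tree_rooted treeT.
have /boolp.choice[tau tauP] v : exists t, v \in beta t.
  by have [[t]] := conT v; rewrite inE; exists t.
apply: (HD _ _ _ _ _ tau rT) => i.
apply: covered_near (alpha_covered (alphaT i)) _ => v vi.
suff [w vw wi] : exists2 w, near m v w & w \in beta i.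
  by exists w => //; rewrite near_sym.
case: (hull_bag_cross rT vi) => [[w vw <-]|[j [jt0 <-] [a [b [ab aj bj va vb]]]]].
  by exists w.
(* A bag containing both [a] and [b] lies on one side of the tree edge above [j]. The end placed on
   the other side has bags on both sides, hence occurs at [pi j]. *)
have [x [ax bx]] := edgeT _ _ ab.
have inX u t : (t \in [set x | u \in beta x]) = (u \in beta t) by rewrite inE.
have [xj|xj] := boolP (desc pi x j).
  have [] := connected_set_separate adjT (conT b) _ xj _ bj; rewrite ?inX //.
  by move=> _ ?; exists b.
have [] := connected_set_separate adjT (conT a) _ aj _ xj; rewrite ?inX //.
by move=> _ ?; exists a.
Qed.

Lemma sim_colouring k m : exists D, forall (G T : sgraph) (L : G -> T),
  branch_decomposition L ->
  (forall x y, adj x y -> cut_sim (branch_side L x y) <= k) ->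
  two_colourable m D G.
Proof.
(* One ball for the vertex placed at the node, if any, and [k] balls for each of the at most three
   edges to its children. *)
have [D HD] := hull_colouring (1 + 3 * k) (m + 2) m; exists D => G T L.
move=> [treeT degT injL _] simT.
have [t0 [pi [h [rT parT adjT]]]] := tree_rooted treeT.
apply: (HD _ _ _ _ _ L rT) => i.
pose cross j := [set v | [exists a, exists b,
  [&& adj a b, desc pi (L a) j, ~~ desc pi (L b) j, near m v a & near m v b]]].
pose J := [set j | (j != t0) && (pi j == i)].
pose B0 := [set v | [exists w, near m v w && (L w == i)]].
have cov0 : covered 1 (m + 2) B0.
  have [/existsP[w /eqP Lw]|nw] := boolP [exists w, L w == i].
    exists [:: w] => // v; rewrite inE => /existsP[w' /andP[vw' /eqP Lw']].
    exists w; first exact: mem_head.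
    by rewrite (injL w w') ?Lw // near_sym; apply: nearW vw'; exact: leq_addr.
  exists [::] => // v; rewrite inE => /existsP[w /andP[_ Lw]].
  by case/negP: nw; apply/existsP; exists w.
have covJ : covered (#|J| * k) (m + 2) (\bigcup_(j in J) cross j).
  apply: covered_bigU => j; rewrite inE => /andP[jt0 _].
  have sideE v : (v \in branch_side L j (pi j)) = desc pi (L v) j.
    by rewrite inE (connect_edge_deleted rT).
  apply: cut_sim_covered (simT _ _ (parT j jt0)) _ => v.
  rewrite inE => /existsP[a /existsP[b /and5P[ab aj bj va vb]]].
  by exists a, b; rewrite !sideE.
apply: coveredW (coveredU cov0 covJ) => //.
  rewrite leq_add2l leq_mul2r; apply/orP; right.
  exact: leq_trans (card_children parT i) (degT i).
apply/fintype.subsetP => v vi; rewrite finset.in_setU; apply/orP.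
case: (hull_bag_cross rT vi) => [[w vw Lw]|[j [jt0 pj] [a [b [ab aj bj va vb]]]]].
  by left; rewrite inE; apply/existsP; exists w; rewrite vw Lw eqxx.
right; apply/finset.bigcupP; exists j; first by rewrite inE jt0 pj eqxx.
rewrite inE; apply/existsP; exists a; apply/existsP; exists b.
by rewrite ab aj bj va vb.
Qed.

(** * From two-colourings to asymptotic dimension *)

Section Reals.
Variable R : realType.

Lemma min_nat_le (P : nat -> Prop) k : (min_nat R P <= (k%:R)%:E)%E ->
  exists2 n, n <= k & P n.
Proof.
move=> Pk; apply: contrapT => nP.
have : ((k.+1%:R)%:E <= min_nat R P)%E.
  apply/ereal_infP => _ [n Pn <-]; rewrite lee_fin ler_nat ltnNge.
  by apply/negP => nk; apply: nP; exists n.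
by move=> /le_trans/(_ Pk); rewrite lee_fin ler_nat ltnn.
Qed.

Lemma gdist_le (G : sgraph) n (u v : G) :
  near n u v -> (gdist R u v <= (n%:R)%:E)%E.
Proof.
move=> /asboolP[p0 [pp0 lp0 sp0]]; apply: ge_ereal_inf.
have := lp0; case/shortenP: pp0 => p pp up sub lp.
exists ((size p)%:R)%:E.
  exists (size p) => //; exists p; split=> //.
rewrite lee_fin ler_nat; apply: leq_trans sp0.
by apply: uniq_leq_size => //; case/andP: up.
Qed.

Lemma gdist_gt (G : sgraph) n (u v : G) :
  ~~ near n u v -> (((n.+1)%:R)%:E <= gdist R u v)%E.
Proof.
move=> nuv; apply/ereal_infP => _ [l [p [pp _ lp sp]] <-].
rewrite lee_fin ler_nat ltnNge; apply: contra nuv => ln.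
by apply/asboolP; exists p; split=> //; rewrite sp.
Qed.

Lemma asdim_le1 (C : sgraph -> Prop) :
  (forall m, exists D, forall G, C G -> two_colourable m D G) ->
  (asdim R C <= 1)%E.
Proof.
move=> /boolp.choice[D HD]; apply: ge_ereal_inf; exists 1%E => //.
(* Finite distances are integers, so only the integer part of [delta] matters. *)
exists 1 => //; exists (fun x => (D (Num.truncn x))%:R%R); split=> [x _|G CG].
  exact: ler0n.
move=> delta d0; set m := Num.truncn delta.
have [c cP] := HD m G CG.
pose e := mono c (near m).
have e_sym : symmetric e by apply: mono_sym => u v; exact: near_sym.
have eqR : {in [set: G] & &, equivalence_rel (connect e)}.
  move=> x y z _ _ _; split; first exact: connect0.
  by move=> xy; exact: (same_connect (sym_connect_sym e_sym) xy).
pose U := equivalence_partition (connect e) [set: G].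
have partU : finset.partition U [set: G] by exact: equivalence_partitionP.
have UP X x y : X \in U -> x \in X -> (y \in X) = connect e x y.
  move=> XU xX; have /and3P[_ trU _] := partU.
  by rewrite -(finset.def_pblock trU XU xX) pblock_equivalence_partition ?inE.
exists U; split=> //.
(* The parts are the monochromatic components; index [ord0] collects those of colour [true]. *)
- exists (fun i => [set X in U | [exists x in X, c x == (i == ord0)]]); split.
    apply/finset.setP => X; apply/idP/finset.bigcupP.
      move=> XU; have /and3P[_ _ U0] := partU.
      have /finset.set0Pn[x xX] : X != finset.set0 by apply: contraNneq U0 => <-.
      exists (if c x then ord0 else ord_max) => //; rewrite inE XU.
      by apply/existsP; exists x; rewrite xX; case: (c x).
    by move=> [i _]; rewrite inE => /andP[].
  move=> i X Y; rewrite !inE => /andP[XU /existsP[x0 /andP[x0X /eqP cx0]]].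
  move=> /andP[YU /existsP[y0 /andP[y0Y /eqP cy0]]] XY.
  apply: lt_bigmin => [|x xX]; first exact: ltry.
  apply: lt_bigmin => [|y yY]; first exact: ltry.
  (* Vertices not within [m] are at distance at least [m.+1], which exceeds [delta] strictly. *)
  apply: (@lt_le_trans _ _ ((m.+1)%:R)%:E).
    by rewrite lte_fin; case/andP: (Num.Theory.truncn_itv d0).
  apply: gdist_gt; apply: contra XY => xy.
  have cx : c x = (i == ord0).
    by rewrite -cx0; apply/esym/(@connect_mono _ c (near m)); rewrite -/e -(UP X).
  have cy : c y = (i == ord0).
    by rewrite -cy0; apply/esym/(@connect_mono _ c (near m)); rewrite -/e -(UP Y).
  have yX : y \in X.
    by rewrite (UP _ _ _ XU xX); apply: connect1; rewrite /e /mono /= xy cx cy eqxx.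
  have /and3P[_ trU _] := partU.
  by rewrite -(finset.def_pblock trU XU yX) -(finset.def_pblock trU YU yY).
- move=> X XU; apply: bigmax_le => [|u uX]; first by rewrite lee_fin ler0n.
  apply: bigmax_le => [|v vX]; first by rewrite lee_fin ler0n.
  by apply/gdist_le/cP; rewrite -/e -(UP X).
Qed.

Lemma branch_width_asdim (f : forall G : sgraph, {set G} -> nat) k :
  (forall (G : sgraph) (A : {set G}), cut_sim A <= f G A) ->
  (asdim R (fun G => branch_width R (f G) <= (k%:R)%:E) <= 1)%E.
Proof.
move=> simf; apply: asdim_le1 => m; have [D HD] := sim_colouring k m.
(* Graphs with at most one vertex have width [0] by convention, with no decomposition at hand. *)
exists D => G; rewrite /branch_width; case: ifPn => [G1 _|_].
  exists (fun=> true) => u v _; suff -> : u = v by apply: nearW (near_refl 0 _).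
  exact: (card_le1_eqP G1).
move=> /min_nat_le[n nk [T [L [decL widthL]]]].
apply: (HD _ _ _ decL) => x y xy; apply: leq_trans (simf _ _) _.
apply: leq_trans nk; rewrite -widthL.
by apply: (bigop.bigmax_sup x) => //; apply: (bigop.bigmax_sup y).
Qed.

End Reals.

Theorem corollary5 (R : realType) (k : nat) (k_gt0 : (0 < k)%N) :
  [/\ (asdim R (fun G => rank_width R G <= (k%:R)%:E) <= 1)%E,
      (asdim R (fun G => tree_independence_number R G <= (k%:R)%:E) <= 1)%E,
      (asdim R (fun G => mim_width R G <= (k%:R)%:E) <= 1)%E
    & (asdim R (fun G => sim_width R G <= (k%:R)%:E) <= 1)%E].
Proof.
split.
- apply: (branch_width_asdim _ (f := @cut_rank)) => G A.
  exact: leq_trans (cut_sim_mim A) (cut_mim_rank A).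
- apply: asdim_le1 => m; have [D HD] := tree_alpha_colouring k m.
  exists D => G /min_nat_le[n nk [T [beta [decT maxT]]]].
  apply: (HD _ _ _ decT) => x; apply: leq_trans nk; rewrite -maxT.
  by apply: (bigop.bigmax_sup x).
- by apply: (branch_width_asdim _ (f := @cut_mim)) => G A; exact: cut_sim_mim.
- exact: (branch_width_asdim _ (f := @cut_sim)).
Qed.
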